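(* Consider an $n$-player team problem with common cost $c$ and compact action spaces, satisfying Assumptions A2, A4 and A6 with fixed channels $Q^1,\dots,Q^n$. For a prior $\zeta$ let $\mu_\zeta(dx,dy^1,\dots,dy^n)=\zeta(dx)\prod_{i=1}^nQ^i(dy^i|x)$, and suppose $\mu_\zeta$ satisfies Assumption A3 for each prior considered. If $\zeta_m\to\zeta$ weakly in $\mathcal{P}(\mathbb{X})$, then $J^*(c,\mu_{\zeta_m})\to J^*(c,\mu_\zeta)$; i.e. the team value function is continuous under weak convergence of the priors.
   Context: $\mathbb{X},\mathbb{Y}^1,\dots,\mathbb{Y}^n$ are standard Borel spaces; $Q^i$ is a stochastic kernel from $\mathbb{X}$ to $\mathbb{Y}^i$. A team problem consists of standard Borel action spaces $\mathbb{U}^i$ and a common cost $c:\mathbb{X}\times\mathbb{U}^1\times\cdots\times\mathbb{U}^n\to\mathbb{R}$. Policies are measurable $\gamma^i:\mathbb{Y}^i\to\mathbb{U}^i$; for an information structure $\mu$ on $\mathbb{X}\times\mathbb{Y}^1\times\cdots\times\mathbb{Y}^n$ and team policy $\bar\gamma$, $J(c,\mu,\bar\gamma)=\int c(x,\gamma^1(y^1),\dots,\gamma^n(y^n))\,d\mu$, and $J^*(c,\mu)=\inf_{\bar\gamma}J(c,\mu,\bar\gamma)$. Weak convergence: $\int f d\zeta_m\to\int f d\zeta$ for all bounded continuous $f$. $\|P-R\|_{TV}=2\sup_B|P(B)-R(B)|$. Assumptions: A2: the cost is continuous and bounded. A3: $\mu_\zeta\ll\zeta(dx)\bar Q^1(dy^1)\cdots\bar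 Q^n(dy^n)$ for some probability measures $\bar Q^i$ on $\mathbb{Y}^i$. A4: each action space is compact. A6: the channels $Q^i$ are fixed and conditionally independent given $x$, and each is continuous in total variation: $x_m\to x$ implies $\|Q^i(\cdot|x_m)-Q^i(\cdot|x)\|_{TV}\to0$. *)

(* Defs.v *)
From HB Require Import structures.
From mathcomp Require Import all_boot all_order all_algebra.
From mathcomp Require Import all_classical all_reals all_analysis.
Set Implicit Arguments. Unset Strict Implicit. Unset Printing Implicit Defensive.
Import Order.TTheory GRing.Theory Num.Theory numFieldNormedType.Exports.
Local Open Scope classical_set_scope.
Local Open Scope ring_scope.

HB.structure Definition TopMeasurable d (R : realType) :=
  {T of Measurable d T & PseudoMetric R T}.
Notation topMeasurableType := TopMeasurable.type.

Definition standard_borel d (R : realType) (T : topMeasurableType d R) : Prop :=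
  [/\ @measurable d T = <<s @open T >>,
      hausdorff_space T,
      (forall F : set_system T, ProperFilter F -> cauchy F -> cvg F)
    & exists D : set T, countable D /\ closure D = setT].

Definition weak_cvg d (R : realType) (X : topMeasurableType d R)
  (zeta_ : nat -> probability X R) (zeta : probability X R) : Prop :=
  forall f : X -> R, continuous f -> (exists M : R, forall x, `|f x| <= M) ->
    ((\int[zeta_ m]_x (f x)%:E) @[m --> \oo] --> \int[zeta]_x (f x)%:E)%E.

Definition tv_dist d (T : measurableType d) (R : realType)
  (P Q : measure T R) : \bar R :=
  (2%:E * ereal_sup [set `|P B - Q B|%E | B in [set B | measurable B]])%E.

Definition tv_continuous d d' (R : realType) (X : topMeasurableType d R)
  (Y : measurableType d') (Q : R.-pker X ~> Y) : Prop :=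
  forall (x_ : nat -> X) (x : X), x_ @ \oo --> x ->
    tv_dist (Q (x_ m)) (Q x) @[m --> \oo] --> 0%E.

Section Iterated.
Context {n : nat} {d : measure_display} {dY : 'I_n -> measure_display}
  {R : realType} {X : measurableType d} {Y : forall i : 'I_n, measurableType (dY i)}.

(* Integrate out the coordinates 0, ..., k-1 of y (in the order k-1 outermost)
   with respect to the measures K i; the other coordinates are those of y. *)
Fixpoint iint (K : forall i : 'I_n, {measure set Y i -> \bar R}) (k : nat)
  (g : (forall i, Y i) -> \bar R) (y : forall i, Y i) {struct k} : \bar R :=
  match k with
  | 0 => g y
  | k'.+1 =>
      match @insub nat (fun j => j < n)%N 'I_n k' with
      | Some i => (\int[K i]_z iint K k' g (@eqtype.dfwith _ (fun j => Y j) y i z))%E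
      | None => iint K k' g y
      end
  end.

Definition kint (zeta : {measure set X -> \bar R})
  (K : X -> forall i : 'I_n, {measure set Y i -> \bar R})
  (f : X -> (forall i, Y i) -> \bar R) : \bar R :=
  (\int[zeta]_x iint (K x) n (f x) (fun i => point))%E.

Definition prod_cyl : set_system (X * (forall i, Y i)) :=
  [set A | (exists2 B : set X, measurable B & A = [set p | B p.1])
        \/ (exists i : 'I_n, exists2 C : set (Y i), measurable C &
              A = [set p | C (p.2 i)])].
Definition prod_measurable : set_system (X * (forall i, Y i)) := <<s prod_cyl >>.

Definition kmeas (zeta : {measure set X -> \bar R})
  (K : X -> forall i : 'I_n, {measure set Y i -> \bar R})
  (A : set (X * (forall i, Y i))) : \bar R :=
  kint zeta K (fun x y => (\1_A (x, y) : R)%:E).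

End Iterated.

Section Team.
Context {R : realType} {n : nat} {dX : measure_display} {X : topMeasurableType dX R}
  {dY : 'I_n -> measure_display} {Y : forall i : 'I_n, topMeasurableType (dY i) R}
  {dU : 'I_n -> measure_display} {U : forall i : 'I_n, topMeasurableType (dU i) R}.

Definition team_policy (gamma : forall i, Y i -> U i) : Prop :=
  forall i, measurable_fun setT (gamma i).

Definition team_cost (Q : forall i, R.-pker X ~> Y i)
  (c : X * prod_topology (fun i => (U i : topologicalType)) -> R) (zeta : probability X R)
  (gamma : forall i, Y i -> U i) : \bar R :=
  kint zeta (fun x i => Q i x) (fun x y => (c (x, fun i => gamma i (y i)))%:E).

Definition team_value (Q : forall i, R.-pker X ~> Y i)
  (c : X * prod_topology (fun i => (U i : topologicalType)) -> R) (zeta : probability X R) : \bar R :=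
  ereal_inf [set team_cost Q c zeta gamma | gamma in team_policy].

Definition assumption_A3 (Q : forall i, R.-pker X ~> Y i) (zeta : probability X R) : Prop :=
  exists Qbar : forall i, probability (Y i) R,
    forall A : set (X * (forall i, Y i)), prod_measurable A ->
      kmeas zeta (fun _ i => Qbar i) A = 0%E ->
      kmeas zeta (fun x i => Q i x) A = 0%E.
End Team.

(* Main.v *)
Require Import Defs.
From HB Require Import structures.
From mathcomp Require Import all_boot all_order all_algebra.
From mathcomp Require Import all_classical all_reals all_analysis.
From mathcomp Require Import measurable_realfun lra.
Set Implicit Arguments. Unset Strict Implicit. Unset Printing Implicit Defensive.
Import Order.TTheory GRing.Theory Num.Theory numFieldNormedType.Exports.
Local Open Scope classical_set_scope.
Local Open Scope ring_scope.

(* Write g_gamma(x) for the expected cost of the policy gamma given x. Integrating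
   the coordinates of y one at a time, compactness of the action spaces and
   continuity of the channels in total variation show that the family of all
   functions g_gamma is equicontinuous; it is also uniformly bounded. On a
   separable space weak convergence is uniform over such a family (Ranga Rao), so
   J(c, mu_(zeta_m), gamma) -> J(c, mu_zeta, gamma) uniformly in gamma and the
   infima converge. *)

(** * Bounded functions and probability measures *)

(** Once policies are substituted, the integrand is merely measurable in [y], with no regularity
    shared by all policies, so continuity cannot be sought on the product with the observations. It
    must come from [x] alone. Total variation helps here because it controls the integrals of all
    measurable functions with a common bound at once, however irregular the policy. Moving [x] also
    moves the integrand, and that change must be small for every action a policy might pick: this is
    where compactness enters. Uniformity in the policy lets the limit pass through the infimum
    without any minimiser. The uniform weak convergence is obtained without tightness: a countable
    family of bumps, on whose supports all the functions oscillate by at most [e], is turned into a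
    partition of unity. Finitely many cells carry almost all the mass of [zeta], and a policy enters
    only through bounded coefficients of their integrals. The leftover mass is the integral of a
    single continuous function, so its smallness passes from [zeta] to [zeta_ m]. *)

Lemma equicontinuousP (R : realType) (T : topologicalType) (I : Type)
    (W : set I) (F : I -> T -> R) :
  equicontinuous W F <-> forall x e, 0 < e ->
    \forall y \near x, forall i, W i -> `|F i x - F i y| < e.
Proof.
split=> [eF x e e0|eF x E].
  exact: (eF x [set p | `|p.1 - p.2| < e] (entourage_ball R (PosNum e0))).
rewrite -entourage_ballE => -[e /= e0 eE].
by apply: filterS (eF x e e0) => y Fy i Wi; apply: eE; exact: Fy.
Qed.

Lemma open_generated_measurable_comp d d' (R : realType) (T : measurableType d)
    (U : topMeasurableType d' R) (g : T -> U) (h : U -> R) :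
  @measurable d' U = <<s @open U >> ->
  measurable_fun setT g -> continuous h -> measurable_fun setT (h \o g).
Proof.
move=> mU mg /continuousP ch; apply: measurableT_comp mg.
apply: (measurability _ (RGenOpens.measurableE R)).
move=> _ [_ [a [b ->] <-]]; rewrite setTI mU.
by apply: sub_sigma_algebra; apply: ch; exact: interval_open.
Qed.

Section probability_Rintegral.
Context d (T : measurableType d) (R : realType) (mu : {measure set T -> \bar R}).
Hypothesis mu1 : mu setT = 1%E.

Lemma bounded_integrableT (f : T -> R) (M : R) : measurable_fun setT f ->
  (forall x, `|f x| <= M) -> mu.-integrable setT (EFin \o f).
Proof.
move=> mf fM; apply: measurable_bounded_integrable => //; first by rewrite mu1 ltry.
by exists M; split; [exact: num_real | move=> r Mr x _; exact: le_trans (fM x) (ltW Mr)].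
Qed.

Lemma Rintegral_norm_le (f : T -> R) (M : R) : measurable_fun setT f ->
  (forall x, `|f x| <= M) -> `|\int[mu]_x f x| <= M.
Proof.
move=> mf fM; have If := bounded_integrableT mf fM.
rewrite (le_trans (le_normr_Rintegral _ If)) //.
have -> : M = \int[mu]_(x in setT) M by rewrite Rintegral_cst // mu1 mulr1.
apply: le_Rintegral => //.
  apply: (bounded_integrableT (M := M)); first exact: measurableT_comp.
  by move=> x; rewrite normr_id.
by apply: (bounded_integrableT (M := `|M|)) => //; exact: measurable_cst.
Qed.

Lemma Rintegral_dist_le (f g : T -> R) (M N e : R) :
  measurable_fun setT f -> measurable_fun setT g ->
  (forall x, `|f x| <= M) -> (forall x, `|g x| <= N) ->
  (forall x, `|f x - g x| <= e) ->
  `|\int[mu]_x f x - \int[mu]_x g x| <= e.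
Proof.
move=> mf mg fM gN fg; rewrite -RintegralB //.
- by apply: Rintegral_norm_le => //; exact: measurable_funB.
- exact: bounded_integrableT fM.
- exact: bounded_integrableT gN.
Qed.

Lemma Rintegral_sum (f : nat -> T -> R) (n : nat) :
  (forall k, mu.-integrable setT (EFin \o f k)) ->
  \int[mu]_x (\sum_(k < n) f k x) = \sum_(k < n) \int[mu]_x f k x.
Proof.
move=> fi; rewrite -[RHS]/(fine (\sum_(k < n) \int[mu]_x f k x)%:E).
congr fine; rewrite -sumEFin.
under eq_integral do rewrite -sumEFin.
rewrite integral_sum //; last by move=> k; exact: fi.
apply: eq_bigr => k _; rewrite fineK //.
exact: (integrable_fin_num _ (fi k)).
Qed.

End probability_Rintegral.

(** The sum rounds [t] down to a multiple of [e]. In the induction, either [t <= N * e] and the new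
    step is zero, or all earlier steps are full and only the last one is in doubt. *)
Lemma staircase_approx (R : realFieldType) (e t : R) (N : nat) :
  0 < e -> 0 <= t <= N%:R * e ->
  `|t - \sum_(j < N) e * (j.+1%:R * e <= t)%R%:R| <= e.
Proof.
move=> e0; elim: N => [|N IH] /andP[t0 tN].
  by rewrite big_ord0 subr0 ger0_norm //; move: tN; rewrite mul0r; lra.
rewrite big_ord_recr /=; have [tNe|Net] := leP t (N%:R * e).
  have -> : (N.+1%:R * e <= t) = false by apply/negbTE; rewrite -ltNge -natr1; lra.
  by rewrite mulr0 addr0 IH // t0.
have -> : \sum_(j < N) e * (j.+1%:R * e <= t)%R%:R = N%:R * e.
  rewrite (eq_bigr (fun=> e)) => [|j _]; first by rewrite sumr_const card_ord mulr_natl.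
  suff -> : j.+1%:R * e <= t by rewrite mulr1.
  by rewrite (le_trans _ (ltW Net)) // ler_pM2r // ler_nat.
rewrite -natr1 in tN *; rewrite ler_norml; case: (leP ((N%:R + 1) * e) t) => h.
  by rewrite mulr1; apply/andP; split; lra.
by rewrite mulr0; apply/andP; split; lra.
Qed.

(* Layer-cake bound: f + M is approximated by a staircase of 2 M / e level
   sets, on each of which the two measures differ by at most del. *)
Lemma Rintegral_setwise_dist d (T : measurableType d) (R : realType)
    (mu nu : {measure set T -> \bar R}) (f : T -> R) (M del : R) :
  mu setT = 1%E -> nu setT = 1%E -> measurable_fun setT f ->
  (forall x, `|f x| <= M) ->
  (forall B, measurable B -> `|fine (mu B) - fine (nu B)| <= del) ->
  `|\int[mu]_x f x - \int[nu]_x f x| <= 2 * M * del.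
Proof.
move=> mu1 nu1 mf fM dB.
have M0 : 0 <= M by rewrite (le_trans _ (fM point)).
apply/ler_addgt0Pr => eta eta0.
(* With this many levels the mesh [e = 2 * M / N.+1] satisfies [2 * e <= eta], which pays one
   staircase error [e] for each measure. *)
have [N] : exists N : nat, 4 * M / eta < N.+1%:R.
  by exists (Num.truncn (4 * M / eta)); rewrite Num.Theory.truncnS_gt.
rewrite ltr_pdivrMr // => NM.
have N0 : 0 < N.+1%:R :> R by rewrite ltr0n.
have [M1|M1] := eqVneq M 0.
  have f0 (la : {measure set T -> \bar R}) : la setT = 1%E -> \int[la]_x f x = 0.
    by move=> la1; have := Rintegral_norm_le la1 mf fM; rewrite M1 normr_le0 => /eqP.
  by rewrite !f0 // subrr normr0 M1 mulr0 mul0r add0r ltW.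
pose e := 2 * M / N.+1%:R.
have eN : N.+1%:R * e = 2 * M by rewrite /e mulrC divfK // gt_eqF.
have e0 : 0 < e by rewrite divr_gt0 // mulr_gt0 // lt_neqAle eq_sym M1.
pose s j x := e * ((j.+1%:R * e <= f x + M)%R)%:R.
pose g x := \sum_(j < N.+1) s j x - M.
have mB j : measurable [set x | j.+1%:R * e <= f x + M].
  rewrite -[X in measurable X]setTI.
  by apply: measurable_fun_le => //; exact: measurable_funD.
have sE' j : s j = fun x => e * \1_[set x | j.+1%:R * e <= f x + M] x.
  by apply/funext => x; rewrite indicE /s mem_setE.
have ms j : measurable_fun setT (s j).
  by rewrite sE'; apply: measurable_funM => //; exact: measurable_indic.
have sM j x : `|s j x| <= e.
  rewrite /s; case: (_ * _ <= _); first by rewrite mulr1 gtr0_norm.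
  by rewrite mulr0 normr0 ltW.
have sI (la : {measure set T -> \bar R}) j : la setT = 1%E ->
    la.-integrable setT (EFin \o s j).
  by move=> la1; exact: bounded_integrableT.
have sE (la : {measure set T -> \bar R}) j : la setT = 1%E ->
    \int[la]_x s j x = e * fine (la [set x | j.+1%:R * e <= f x + M]).
  move=> la1; rewrite sE' RintegralZl //; last first.
    apply: (bounded_integrableT la1 (M := 1)); first exact: measurable_indic.
    by move=> x; rewrite indicE; case: (_ \in _); rewrite ?normr1 ?normr0.
  by congr (_ * fine _); rewrite integral_indic // setIT.
have sumM x : 0 <= \sum_(j < N.+1) s j x <= 2 * M.
  rewrite sumr_ge0 => [|j _]; last by rewrite /s mulr_ge0 // ltW.
  rewrite -eN (le_trans (ler_sum (G := fun=> e) _ _)) //.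
    by move=> j _; exact: le_trans (ler_norm _) (sM j x).
  by rewrite sumr_const card_ord mulr_natl.
have mS : measurable_fun setT (fun x => \sum_(j < N.+1) s j x).
  exact: measurable_sum.
have gI (la : {measure set T -> \bar R}) : la setT = 1%E ->
    la.-integrable setT (EFin \o fun x => \sum_(j < N.+1) s j x).
  move=> la1; apply: (bounded_integrableT la1 (M := 2 * M)) => // x.
  by have /andP[s0 s1] := sumM x; rewrite ger0_norm.
have gE (la : {measure set T -> \bar R}) : la setT = 1%E ->
    \int[la]_x g x =
      \sum_(j < N.+1) e * fine (la [set x | j.+1%:R * e <= f x + M]) - M.
  move=> la1; rewrite RintegralB //.
  - rewrite Rintegral_sum //; last by move=> j; exact: sI.
    rewrite Rintegral_cst // la1 mulr1; congr (_ - _).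
    by apply: eq_bigr => j _; rewrite sE.
  - exact: gI.
  - by apply: (bounded_integrableT la1 (M := `|M|)) => //; exact: measurable_cst.
have fg (la : {measure set T -> \bar R}) : la setT = 1%E ->
    `|\int[la]_x f x - \int[la]_x g x| <= e.
  move=> la1; apply: (Rintegral_dist_le la1 mf _ fM (N := M)).
  - exact: measurable_funB.
  - by move=> x; have /andP[? ?] := sumM x; rewrite /g ler_norml; apply/andP; split; lra.
  move=> x.
  rewrite /g opprB addrA; apply: staircase_approx => //; rewrite eN.
  by have := fM x; rewrite ler_norml => /andP[? ?]; apply/andP; split; lra.
(* Each level set costs at most [e * del] and [N.+1 * e = 2 * M], so the bound does not depend on
   the mesh. *)
have gg : `|\int[mu]_x g x - \int[nu]_x g x| <= 2 * M * del.
  rewrite !gE // opprB addrA subrK -sumrB -eN.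
  rewrite (le_trans (ler_norm_sum _ _ _)) //.
  rewrite (le_trans (ler_sum (G := fun=> e * del) _ _)) //.
    move=> j _; rewrite -mulrBr normrM gtr0_norm // ler_wpM2l //; first exact: ltW.
    exact: dB.
  by rewrite sumr_const card_ord -mulrA mulr_natl.
have := fg _ mu1; have := fg _ nu1; have : 2 * e <= eta.
  by rewrite /e mulrA ler_pdivrMr //; lra.
move: gg; rewrite !ler_norml => /andP[? ?] ? /andP[? ?] /andP[? ?].
by apply/andP; split; lra.
Qed.

(** * Integrating out one coordinate *)

(** Passes from sequences to neighbourhoods: if every ball of radius [1 / n.+1] contained a bad
    point, these points would form a sequence tending to [x] that contradicts [tv_continuous]. *)
Lemma tv_continuous_near d d' (R : realType) (X : topMeasurableType d R)
    (Y : measurableType d') (Q : R.-pker X ~> Y) (x : X) (e : R) :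
  tv_continuous Q -> 0 < e ->
  \forall x' \near x, forall B, measurable B ->
    `|fine (Q x B) - fine (Q x' B)| <= e.
Proof.
move=> cQ e0; apply: contrapT => nQ.
have H n : exists x', ball x n.+1%:R^-1 x' /\
    ~ forall B, measurable B -> `|fine (Q x B) - fine (Q x' B)| <= e.
  apply: contrapT => /forallNP nx; apply: nQ.
  have n0 : 0 < n.+1%:R^-1 :> R by rewrite invr_gt0.
  apply: filterS (nbhsx_ballx x _ n0) => x' xx'.
  by apply: contrapT => nx'; apply: (nx x').
have [x_ Hx] := choice H.
have : x_ @ \oo --> x.
  apply/cvg_ballP => eta eta0.
  near=> m; apply: (@le_ball _ _ _ m.+1%:R^-1); last by have [] := Hx m.
  by near: m; apply: filterS (near_infty_natSinv_lt (PosNum eta0)) => m /ltW.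
move=> /cQ/fine_cvgP[tvfin /cvgrPdist_lt /(_ _ e0) tve].
have [m [mfin me]] : exists m, tv_dist (Q (x_ m)) (Q x) \is a fin_num /\
    `|0 - fine (tv_dist (Q (x_ m)) (Q x))| < e.
  by apply: (@filter_ex _ \oo); near=> m; split; near: m.
have [_] := Hx m; apply => B mB; rewrite distrC.
have kfin y : Q y B \is a fin_num.
  have : (Q y B <= Q y setT)%E by apply: le_measure; rewrite ?inE //; exact: measurableT.
  rewrite (@prob_kernel _ _ _ _ _ Q) ge0_fin_numE // => /le_lt_trans.
  by apply; exact: ltry.
rewrite -lee_fin -[(`|_|%R)%:E]/(`|(_ - _)%:E|)%E EFinB !fineK //.
have supB A : measurable A -> (`|Q (x_ m) A - Q x A| <= tv_dist (Q (x_ m)) (Q x))%E.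
  move=> mA; have sA : (`|Q (x_ m) A - Q x A| <= ereal_sup
      [set `|Q (x_ m) C - Q x C| | C in [set C | measurable C]])%E.
    by apply: ereal_sup_ubound; exists A.
  (* The factor 2 in [tv_dist] only enlarges the supremum, which is nonnegative by [sA]. *)
  rewrite (le_trans sA) // /tv_dist lee_pemull // ?lee1n //.
  by rewrite (le_trans _ sA).
rewrite (le_trans (supB _ mB)) // -[leLHS]fineK // lee_fin.
by move: me; rewrite sub0r normrN => /ltW; apply: le_trans; exact: ler_norm.
Unshelve. all: by end_near. Qed.

Lemma continuous_dfwith2 (I : eqType) (K : I -> topologicalType) (i : I) :
  continuous (fun p : prod_topology K * K i =>
    @eqtype.dfwith I (fun j => K j) p.1 i p.2 : prod_topology K).
Proof.
move=> p; apply/cvg_sup => j A [_ [[V oV <-] /= Vp]] /filterS; apply.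
have : {for p, continuous (fun q : prod_topology K * K i =>
    @eqtype.dfwith I (fun j => K j) q.1 i q.2 j)}.
  case: (eqVneq i j) Vp => [ij _|ij _].
    subst j; rewrite (_ : (fun _ => _) = snd); first exact: cvg_snd.
    by apply/funext => q; rewrite dfwith_in.
  rewrite (_ : (fun _ => _) = proj j \o fst).
    by apply: (@continuous_comp _ _ _ (@fst (prod_topology K) (K i)) (proj j));
      [exact: cvg_fst|exact: proj_continuous].
  by apply/funext => q; rewrite dfwith_out.
by apply; exact: open_nbhs_nbhs.
Qed.

Lemma continuous_pair (T U V : topologicalType) (f : T -> U) (g : T -> V) (x : T) :
  {for x, continuous f} -> {for x, continuous g} ->
  {for x, continuous (fun y => (f y, g y))}.
Proof. by move=> cf cg; exact: (cvg_pair cf cg). Qed.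

Lemma continuous_prod_dfwith (T : topologicalType) (I : eqType)
    (K : I -> topologicalType) (i : I) :
  continuous (fun p : (T * prod_topology K) * K i =>
    (p.1.1, @eqtype.dfwith I (fun j => K j) p.1.2 i p.2) : T * prod_topology K).
Proof.
move=> p.
have c1 : {for p, continuous (@fst (T * prod_topology K) (K i))} by exact: cvg_fst.
have c0 : {for p, continuous (fun q : (T * prod_topology K) * K i => q.1.1)}.
  by apply: (continuous_comp c1 (g := fst)); exact: cvg_fst.
have c2 : {for p, continuous (fun q : (T * prod_topology K) * K i => q.1.2)}.
  by apply: (continuous_comp c1 (g := snd)); exact: cvg_snd.
have c3 : {for p, continuous (@snd (T * prod_topology K) (K i))} by exact: cvg_snd.
have c4 := continuous_pair c2 c3.
have c5 := continuous_comp c4 (@continuous_dfwith2 I K i _).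
exact: (continuous_pair c0 c5).
Qed.

Section integrate_coordinate.
Context {R : realType} {I : Type} {n : nat} {dX : measure_display}
  {X : topMeasurableType dX R} {dY : 'I_n -> measure_display}
  {Y : forall i : 'I_n, topMeasurableType (dY i) R} {dU : 'I_n -> measure_display}
  {U : forall i : 'I_n, topMeasurableType (dU i) R}.
Let PU := prod_topology (fun i : 'I_n => (U i : topologicalType)).
Variables (i : 'I_n) (q : R.-pker X ~> Y i) (W : set I) (gam : I -> Y i -> U i).
Hypotheses (mU : @measurable _ (U i) = <<s @open (U i) >>)
  (kU : compact [set: U i]) (cq : tv_continuous q)
  (mgam : forall j, W j -> measurable_fun setT (gam j)).

Definition coord_integral (F : I -> X * PU -> R) (j : I) (p : X * PU) : R :=
  \int[q p.1]_z F j (p.1, eqtype.dfwith p.2 (gam j z)).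

Variables (F : I -> X * PU -> R) (M : R).
Hypotheses (eF : equicontinuous W F) (FM : forall j p, W j -> `|F j p| <= M).

(** [F j] is continuous in the action put at coordinate [i], and [z] enters only through the
    measurable [gam j]. *)
Lemma measurable_coord_section j x u : W j ->
  measurable_fun setT (fun z => F j (x, eqtype.dfwith u (gam j z))).
Proof.
move=> Wj; apply: (open_generated_measurable_comp mU (mgam Wj)
  (h := fun v => F j (x, eqtype.dfwith u v))) => v.
have cF : {for ((x, eqtype.dfwith u v) : X * PU), continuous (F j)}.
  apply/cvgrPdist_lt => e e0.
  have := (equicontinuousP W F).1 eF (x, eqtype.dfwith u v) _ e0.
  by apply: filterS => y /(_ _ Wj).
have cJ := @continuous_prod_dfwith X _
  (fun i : 'I_n => (U i : topologicalType)) i ((x, u), v).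
have c1 : {for v, continuous (cst ((x, u) : X * PU) : U i -> X * PU)}.
  exact: cvg_cst.
have c2 : {for v, continuous (@id (U i))} by exact: cvg_id.
exact: (continuous_comp (continuous_pair c1 c2) (continuous_comp cJ cF)).
Qed.

Lemma coord_integral_bounded j p : W j -> `|coord_integral F j p| <= M.
Proof.
move=> Wj; apply: Rintegral_norm_le; first exact: prob_kernel.
  exact: measurable_coord_section.
by move=> z; exact: FM.
Qed.

Lemma coord_integral_equicontinuous : equicontinuous W (coord_integral F).
Proof.
apply/equicontinuousP => -[x u] e e0.
(* [M] bounds [F] only for indices in [W], so [M + 1 <= 0] leaves [W] empty. Dividing by [M + 1]
   rather than [M] covers [M = 0]. *)
have [M0|M0] := ltP 0 (M + 1); last first.
  by near=> p => j Wj; have := FM (x, u) Wj; have := normr_ge0 (F j (x, u)); lra.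
have e4 : 0 < e / (4 * (M + 1)) by rewrite divr_gt0 // mulr_gt0.
(* [v] stands for the unknown action [gam j z]. Compactness gives one neighbourhood of [(x, u)]
   valid for all [v], hence for all policies and observations. *)
pose P (p : X * PU) (v : U i) := forall j, W j ->
  `|F j (x, eqtype.dfwith u v) - F j (p.1, eqtype.dfwith p.2 v)| <= e / 4.
have nF : \forall p \near ((x, u) : X * PU), [set: U i] `<=` P p.
  apply: ((compact_near_coveringP [set: U i]).1 kU (X * PU)%type
    (nbhs ((x, u) : X * PU)) P _) => v _.
  have e8 : 0 < e / 8 by rewrite divr_gt0.
  have Fv := (equicontinuousP W F).1 eF (x, eqtype.dfwith u v) _ e8.
  have cJ := @continuous_prod_dfwith X _
    (fun i : 'I_n => (U i : topologicalType)) i ((x, u), v).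
  have := cJ _ Fv; case=> -[A B] /= [nA nB] AB.
  exists (B, A) => // -[v' p] [/= Bv' Ap] j Wj.
  have := AB (p, v') (conj Ap Bv') j Wj.
  have := AB ((x, u), v') (conj (nbhs_singleton nA) Bv') j Wj.
  rewrite /= !ltr_norml !ler_norml => /andP[? ?] /andP[? ?].
  by apply/andP; split; lra.
have nq : \forall p \near ((x, u) : X * PU), forall B, measurable B ->
    `|fine (q x B) - fine (q p.1 B)| <= e / (4 * (M + 1)).
  exact: (cvg_fst (tv_continuous_near x cq e4)).
near=> p => j Wj.
have h : [set: U i] `<=` P p by near: p.
have qp : forall B, measurable B -> `|fine (q x B) - fine (q p.1 B)| <= e / (4 * (M + 1)).
  by near: p.
rewrite /coord_integral /=.
have pk y : q y setT = 1%E by exact: prob_kernel.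
have mF y v := measurable_coord_section y v Wj.
have /= h1 := Rintegral_setwise_dist (pk x) (pk p.1) (mF x u) (fun z => FM _ Wj) qp.
have /= h2 := Rintegral_dist_le (pk p.1) (mF x u) (mF p.1 p.2)
  (fun z => FM _ Wj) (fun z => FM _ Wj) (fun z => h (gam j z) Logic.I j Wj).
(* Change the kernel with the integrand frozen at [(x, u)], then the integrand under the new kernel:
   the errors are at most [e / 2] and [e / 4]. *)
rewrite -(subrKA (\int[q p.1]_z F j (x, eqtype.dfwith u (gam j z)))).
rewrite (le_lt_trans (ler_normD _ _)) // (le_lt_trans (lerD h1 h2)) //.
suff : 2 * M * (e / (4 * (M + 1))) <= e / 2 by lra.
by rewrite mulrA ler_pdivrMr ?mulr_gt0 //; nra.
Unshelve. all: by end_near. Qed.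

End integrate_coordinate.

(** * The expected cost given the state *)

Section partial_cost.
Context {R : realType} {n : nat} {dX : measure_display}
  {X : topMeasurableType dX R} {dY : 'I_n -> measure_display}
  {Y : forall i : 'I_n, topMeasurableType (dY i) R} {dU : 'I_n -> measure_display}
  {U : forall i : 'I_n, topMeasurableType (dU i) R}.
Let PU := prod_topology (fun i : 'I_n => (U i : topologicalType)).
Variables (Q : forall i, R.-pker X ~> Y i) (c : X * PU -> R) (M : R).
Hypotheses (mU : forall i, @measurable _ (U i) = <<s @open (U i) >>)
  (kU : forall i, compact [set: U i]) (cQ : forall i, tv_continuous (Q i))
  (cc : continuous c) (cM : forall p, `|c p| <= M).
Local Notation policy := (forall i, Y i -> U i).

(* The actions u i with i < k are dummies. Keeping them makes every partial cost
   a function on the same space X * PU, and composing it with the policies only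
   after the integration avoids joint measurability on the product of the Y i. *)
Fixpoint partial_cost (k : nat) : policy -> X * PU -> R :=
  match k with
  | 0 => fun=> c
  | k'.+1 =>
      match @insub nat (fun j => j < n)%N 'I_n k' with
      | Some i => coord_integral (Q i) (fun gamma => gamma i) (partial_cost k')
      | None => partial_cost k'
      end
  end.

Let policy_measurable i (gamma : policy) :
  team_policy gamma -> measurable_fun setT (gamma i).
Proof. by apply. Qed.

(** Both properties go through one induction, since each integration step needs both for the
    previous partial cost. At [k = 0] the family is the single function [c], so equicontinuity is
    continuity. *)
Lemma partial_cost_spec k :
  equicontinuous team_policy (partial_cost k) /\
  forall gamma p, team_policy gamma -> `|partial_cost k gamma p| <= M.
Proof.
elim: k => [|k [eF FM]] /=.
  split=> [|gamma p _]; last exact: cM.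
  apply/equicontinuousP => p e e0.
  have /cvgrPdist_lt/(_ e e0) : {for p, continuous c} by exact: cc.
  by apply: filterS.
case: insub => [i|] //; split.
- exact: (coord_integral_equicontinuous (mU i) (kU (i := i)) (cQ i)
    (@policy_measurable i) eF FM).
- by move=> gamma p Wg;
    exact: (coord_integral_bounded (Q i) (mU i) (@policy_measurable i) eF FM p Wg).
Qed.

(** Applying the policies commutes with updating a coordinate: replacing [y i] by [z] replaces the
    action at [i] by [gamma i z] and leaves the others alone. *)
Lemma iint_partial_cost k gamma x (y : forall i, Y i) : team_policy gamma ->
  iint (fun i => Q i x) k (fun y => (c (x, fun i => gamma i (y i)))%:E) y =
  (partial_cost k gamma (x, fun i => gamma i (y i)))%:E.
Proof.
move=> Wg; elim: k y => [//|k IH] y /=.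
case: insub => [i|] //.
have [eF FM] := partial_cost_spec k.
have mH := measurable_coord_section (mU i) (@policy_measurable i) eF x
  (fun j => gamma j (y j)) Wg.
have iH := bounded_integrableT (@prob_kernel _ _ _ _ _ (Q i) x) mH (fun z => FM _ _ Wg).
rewrite /coord_integral /Rintegral fineK /=; last exact: integrable_fin_num iH.
apply: eq_integral => z _; rewrite IH; congr (partial_cost k gamma (x, _))%:E.
apply: functional_extensionality_dep => j.
have [ij|ij] := eqVneq i j; first by subst j; rewrite !dfwith_in.
by rewrite !dfwith_out.
Qed.

(** The dummy actions come from the tuple of [point]s at which [kint] starts; all [n] of them are
    overwritten by the integrations. *)
Definition conditional_cost (gamma : policy) (x : X) : R :=
  partial_cost n gamma (x, fun i => gamma i point).

Lemma conditional_cost_bounded gamma x : team_policy gamma ->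
  `|conditional_cost gamma x| <= M.
Proof. by move=> Wg; exact: (partial_cost_spec n).2. Qed.

(** The dummy action tuple varies with [gamma], so equicontinuity at one point [(x, u)] does not
    suffice. Tychonoff makes the whole action product compact and the estimate uniform in [u]. *)
Lemma conditional_cost_equicontinuous : equicontinuous team_policy conditional_cost.
Proof.
have [eF _] := partial_cost_spec n.
have kPU : compact [set: PU].
  have := @tychonoff 'I_n (fun i => U i) (fun i => setT) kU.
  by congr compact; apply/seteqP; split.
apply/equicontinuousP => x e e0.
pose P (x' : X) (u : PU) := forall gamma, team_policy gamma ->
  `|partial_cost n gamma (x, u) - partial_cost n gamma (x', u)| < e.
suff nP : \forall x' \near x, [set: PU] `<=` P x'.
  by apply: filterS nP => x' h gamma Wg; exact: (h _ Logic.I gamma Wg).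
apply: ((compact_near_coveringP [set: PU]).1 kPU X (nbhs x) P _) => u _.
have e2 : 0 < e / 2 by rewrite divr_gt0.
have [[A B] /= [nA nB] AB] := (equicontinuousP _ _).1 eF (x, u) _ e2.
exists (B, A) => // -[u' x'] [/= Bu' Ax'] gamma Wg.
have := AB (x', u') (conj Ax' Bu') gamma Wg.
have := AB (x, u') (conj (nbhs_singleton nA) Bu') gamma Wg.
rewrite /= !ltr_norml => /andP[? ?] /andP[? ?].
by apply/andP; split; lra.
Qed.

Lemma team_costE (zeta : probability X R) gamma : team_policy gamma ->
  team_cost Q c zeta gamma = (\int[zeta]_x (conditional_cost gamma x)%:E)%E.
Proof.
by move=> Wg; apply: eq_integral => x _; rewrite iint_partial_cost.
Qed.

End partial_cost.

(** * Weak convergence is uniform on bounded equicontinuous families *)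

Lemma countable_dense_seq (T : ptopologicalType) (D : set T) :
  countable D -> closure D = setT ->
  exists s : nat -> T, forall (x : T) (A : set T), nbhs x A -> exists k, A (s k).
Proof.
move=> /pfcard_geP[-> cD|[s] cD].
  have p0 : closure (set0 : set T) (point : T) by rewrite cD.
  by have [y []] := p0 setT filterT.
exists s => x A nA; have : closure D x by rewrite cD.
by move=> /(_ A nA)[_ [/(@surj _ _ _ _ s)[k _ <-] Ask]]; exists k.
Qed.

(** * Tent functions and a countable cover by bumps *)

Section tent.
Context {R : realType} {X : pseudoMetricType R}.

(** The structure provides balls rather than a real distance, and [edist] may be infinite; the
    maximum with 0 is taken before [fine], so such points get height 0. *)
Definition tent (a : X) (r : R) (x : X) : R := fine (maxe 0%:E (r%:E - edist (a, x)))%E.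

Lemma tentE a r x : 0 < r -> (tent a r x)%:E = maxe 0%:E (r%:E - edist (a, x))%E.
Proof.
move=> r0; rewrite fineK //; have := edist_ge0 (a, x).
by case: (edist _) => [d| |] //= d0; rewrite /maxe; case: ifP.
Qed.

Lemma tent_ge0 a r x : 0 < r -> 0 <= tent a r x.
Proof. by move=> r0; rewrite -lee_fin tentE // le_max lexx. Qed.

Lemma tent_le a r x : 0 < r -> tent a r x <= r.
Proof.
move=> r0; rewrite -lee_fin tentE // ge_max lee_fin ltW //=.
have := edist_ge0 (a, x); case: (edist _) => [d| |] //= d0; last by rewrite leNye.
by rewrite -EFinB lee_fin gerBl -lee_fin.
Qed.

Lemma tent_neq0_ball a r x : 0 < r -> tent a r x != 0 -> ball a r x.
Proof.
move=> r0; rewrite -eqe tentE // => t0; apply: (@edist_lt_ball _ _ _ (a, x)).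
by apply: contraNT t0; rewrite -leNgt => h; rewrite max_l // sube_le0.
Qed.

Lemma tent_gt0 a r s x : 0 < s < r -> ball a s x -> 0 < tent a r x.
Proof.
move=> /andP[s0 sr] /(@edist_fin _ _ s (a, x) s0) asx.
rewrite -lte_fin tentE ?(lt_trans s0) // lt_max ltxx /= sube_gt0.
by rewrite (le_lt_trans asx) // lte_fin.
Qed.

Lemma tent_continuous a r : 0 < r -> continuous (tent a r).
Proof.
move=> r0 x; apply/cvgrPdist_le => e e0.
have tri y z : ball y e z -> tent a r y <= tent a r z + e.
  move=> yz; rewrite -lee_fin EFinD !tentE //.
  have d : (edist (a, z) <= edist (a, y) + e%:E)%E.
    rewrite (le_trans (edist_triangle a y z)) // leeD2l //.
    exact: (@edist_fin _ _ e (y, z)).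
  rewrite ge_max; apply/andP; split.
    by apply: adde_ge0; [rewrite le_max lexx|rewrite lee_fin ltW].
  apply: (@le_trans _ _ (r%:E - edist (a, z) + e%:E)%E); last first.
    by rewrite leeD2r // le_max lexx orbT.
  have := edist_ge0 (a, y); have := edist_ge0 (a, z); move: d.
  case: (edist (a, y)) => [d1| |] //=; case: (edist (a, z)) => [d2| |] //=.
  by rewrite !lee_fin; lra.
by move=> *; rewrite leNye.
apply: filterS (nbhsx_ballx x _ e0) => y xy.
have := tri _ _ xy; have := tri _ _ (ball_sym xy).
by rewrite ler_norml => ? ?; apply/andP; split; lra.
Qed.

End tent.

(** The bumps are tents over balls with centre in a dense sequence and radius [1 / j.+1]. A tent is
    kept only if its ball is [good], that is, the whole family stays within [e] of its value at the
    centre; otherwise it is replaced by 0. *)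
Lemma equicontinuous_bumps (R : realType) (X : pseudoPMetricType R) (I : Type)
    (W : set I) (G : I -> X -> R) (e : R) (D : set X) :
  countable D -> closure D = setT -> equicontinuous W G -> 0 < e ->
  exists (phi : nat -> X -> R) (a : nat -> X),
  [/\ forall k, continuous (phi k), forall k x, 0 <= phi k x <= 1,
      forall k x i, phi k x != 0 -> W i -> `|G i (a k) - G i x| <= e &
      forall x, exists k, 0 < phi k x].
Proof.
move=> cD dD eG e0; have [s sD] := countable_dense_seq cD dD.
pose rad (j : nat) : R := j.+1%:R^-1.
have rad0 j : 0 < rad j by rewrite invr_gt0.
pose good k j := `[< forall x i, ball (s k) (rad j) x -> W i ->
  `|G i (s k) - G i x| <= e >].
pose psi k j x := if good k j then tent (s k) (rad j) x else 0.
(* Numbers that code no pair merely repeat the bump of [(0, 0)]. *)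
pose pr m : nat * nat := odflt (0, 0)%N (unpickle m).
exists (fun m => psi (pr m).1 (pr m).2), (fun m => s (pr m).1); split.
- move=> m; rewrite /psi; case: (good _ _); first exact: tent_continuous.
  by move=> x; exact: cvg_cst.
- move=> m x; rewrite /psi; case: (good _ _); last by rewrite lexx ler01.
  by rewrite tent_ge0 // (le_trans (tent_le _ _ _)) // invf_le1 // ler1n.
- move=> m x i; rewrite /psi; case: ifPn => [/asboolP g|]; last by rewrite eqxx.
  by move=> /tent_neq0_ball t Wi; apply: g => //; exact: t.
- move=> x.
  have e2 : 0 < e / 2 by rewrite divr_gt0.
  have /nbhs_ballP[d /= d0 dG] := (equicontinuousP W G).1 eG x _ e2.
  (* With a centre within [rad j / 2] of [x], the ball of radius [rad j] lies in [ball x d].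
     Comparing centre and point through [x] costs [e / 2] twice, and the tent is positive at [x]. *)
  have [j jd] : exists j, rad j < d / 2.
    have d2 : 0 < d / 2 by rewrite divr_gt0.
    by apply: (@filter_ex _ \oo); exact: (near_infty_natSinv_lt (PosNum d2)).
  have r2 : 0 < rad j / 2 by rewrite divr_gt0.
  have [k xk] := sD x _ (nbhsx_ballx x _ r2).
  have gkj : good k j.
    apply/asboolP => y i ky Wi.
    have h1 : `|G i x - G i (s k)| < e / 2.
      by apply: dG => //; apply: le_ball xk; have := rad0 j; lra.
    have h2 : `|G i x - G i y| < e / 2.
      by apply: dG => //; apply: le_ball (ball_triangle xk ky); have := rad0 j; lra.
    move: h1 h2; rewrite !ltr_norml ler_norml => /andP[? ?] /andP[? ?].
    by apply/andP; split; lra.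
  exists (pickle (k, j)); rewrite /psi /pr pickleK /= gkj.
  apply: (@tent_gt0 _ _ _ _ (rad j / 2)); last exact: ball_sym.
  by rewrite r2 /=; have := rad0 j; lra.
Qed.

Lemma weak_cvg_Rintegral d (R : realType) (X : topMeasurableType d R)
    (zeta_ : nat -> probability X R) (zeta : probability X R) (f : X -> R) (M e : R) :
  @measurable d X = <<s @open X >> -> weak_cvg zeta_ zeta ->
  continuous f -> (forall x, `|f x| <= M) -> 0 < e ->
  \forall m \near \oo, `|\int[zeta_ m]_x f x - \int[zeta]_x f x| <= e.
Proof.
move=> mX wz cf fM e0.
have mf : measurable_fun setT f.
  exact: (open_generated_measurable_comp mX (@measurable_id _ X setT) cf).
have If := bounded_integrableT (@probability_setT _ _ _ zeta) mf fM.
have /fine_cvg : ((\int[zeta_ m]_x (f x)%:E) @[m --> \oo] --> (\int[zeta]_x f x)%:E)%E.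
  by rewrite /Rintegral fineK; [apply: wz => //; exists M|exact: integrable_fin_num If].
move=> /cvgrPdist_le/(_ e e0); apply: filterS => m.
by rewrite distrC.
Qed.

(** * A partition of unity with vanishing rest *)

Section partition.
Context {R : realType} {T : topologicalType} (phi : nat -> T -> R).
Hypotheses (cphi : forall k, continuous (phi k)) (phi01 : forall k x, 0 <= phi k x <= 1).

(* For fixed N the successive differences of residual N form a partition of
   unity subordinate to the supports of the phi k, up to the rest residual N N.
   The exponent N makes this rest vanish as N grows, even at a point where a
   single phi k is positive. *)
Definition residual (N k : nat) (x : T) : R := \prod_(j < k) (1 - phi j x) ^+ N.

Lemma residual01 N k x : 0 <= residual N k x <= 1.
Proof.
have p01 j : 0 <= (1 - phi j x) ^+ N <= 1.
  have /andP[p0 p1] := phi01 j x.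
  by rewrite exprn_ge0 ?subr_ge0 //= exprn_ile1 ?subr_ge0 // gerBl.
rewrite prodr_ge0 => [|j _]; last by have /andP[] := p01 j.
by rewrite /residual; apply: prodr_ile1 => j _; exact: p01.
Qed.

Lemma residual_continuous N k : continuous (residual N k).
Proof.
move=> x; rewrite /residual; elim: k => [|k IH].
  by under eq_fun do rewrite big_ord0; exact: cvg_cst.
under eq_fun do rewrite big_ord_recr /=.
apply: cvgM; first exact: IH.
have cB : {for x, continuous (fun y => 1 - phi k y)}.
  by apply: cvgB; [exact: cvg_cst|exact: cphi].
exact: (continuous_comp cB (@exprn_continuous R N _)).
Qed.

Lemma residualS N k x : residual N k.+1 x = residual N k x * (1 - phi k x) ^+ N.
Proof. by rewrite /residual big_ord_recr. Qed.

Lemma residual_le N k x : residual N k.+1 x <= residual N k x.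
Proof.
rewrite residualS ler_piMr //; first by have /andP[] := residual01 N k x.
have /andP[p0 p1] := phi01 k x.
by rewrite exprn_ile1 ?subr_ge0 // gerBl.
Qed.

(** For [N > k] the product contains the factor [(1 - phi k x) ^+ N], a geometric sequence tending
    to 0, and all other factors are at most 1. *)
Lemma residual_cvg0 x : (exists k, 0 < phi k x) -> residual N N x @[N --> \oo] --> 0.
Proof.
move=> [k pk]; have /andP[p0 p1] := phi01 k x.
apply: (@squeeze_cvgr _ _ _ _ (cst 0) (fun N => (1 - phi k x) ^+ N)); last 2 first.
- exact: cvg_cst.
- by apply: cvg_expr; rewrite ger0_norm ?subr_ge0 // gtrBl.
exists k.+1 => // N /= kN; have /andP[-> _] /= := residual01 N N x.
suff H K : (k < K)%N -> residual N K x <= (1 - phi k x) ^+ N by exact: H.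
elim: K => // K IH; rewrite ltnS leq_eqVlt => /orP[/eqP <-|kK].
  rewrite residualS ler_piMl //; first by rewrite exprn_ge0 // subr_ge0.
  by have /andP[] := residual01 N k x.
exact: le_trans (residual_le _ _ _) (IH kK).
Qed.

End partition.

Section equicontinuous_weak_cvg.
Context d (R : realType) (X : topMeasurableType d R) (I : Type) (W : set I)
  (G : I -> X -> R) (M : R).
Hypotheses (mX : @measurable d X = <<s @open X >>) (M0 : 0 <= M)
  (eG : equicontinuous W G) (GM : forall i x, W i -> `|G i x| <= M).

Let continuous_measurable (f : X -> R) : continuous f -> measurable_fun setT f.
Proof. exact: (open_generated_measurable_comp mX (@measurable_id _ X setT)). Qed.

Lemma equicontinuous_measurable i : W i -> measurable_fun setT (G i).
Proof.
move=> Wi; apply: continuous_measurable => x; apply/cvgrPdist_lt => e e0.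
have := (equicontinuousP W G).1 eG x _ e0.
by apply: filterS => y; exact.
Qed.

Variables (phi : nat -> X -> R) (a : nat -> X) (e : R).
Hypotheses (cphi : forall k, continuous (phi k)) (phi01 : forall k x, 0 <= phi k x <= 1)
  (phiG : forall k x i, phi k x != 0 -> W i -> `|G i (a k) - G i x| <= e)
  (phi_cover : forall x, exists k, 0 < phi k x) (e0 : 0 < e).
Let cell N k x := residual phi N k x - residual phi N k.+1 x.

Lemma integrable_residual (mu : probability X R) N k :
  mu.-integrable setT (EFin \o residual phi N k).
Proof.
apply: (bounded_integrableT (probability_setT mu) (M := 1)).
  exact/continuous_measurable/residual_continuous.
by move=> x; have /andP[? ?] := residual01 phi01 N k x; rewrite ger0_norm.
Qed.

Lemma cell_ge0 N k x : 0 <= cell N k x.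
Proof. by rewrite subr_ge0 residual_le. Qed.

Lemma cell_le1 N k x : `|cell N k x| <= 1.
Proof.
rewrite ger0_norm ?cell_ge0 // /cell.
have /andP[? ?] := residual01 phi01 N k x.
by have /andP[? ?] := residual01 phi01 N k.+1 x; lra.
Qed.

Lemma cell_continuous N k : continuous (cell N k).
Proof. by move=> x; apply: cvgB; apply: residual_continuous. Qed.

Lemma integrable_cell (mu : probability X R) N k : mu.-integrable setT (EFin \o cell N k).
Proof.
apply: (bounded_integrableT (probability_setT mu) (M := 1)); last exact: cell_le1.
exact/continuous_measurable/cell_continuous.
Qed.

Lemma sum_cell N m x : \sum_(k < m) cell N k x = 1 - residual phi N m x.
Proof.
elim: m => [|m IH]; first by rewrite big_ord0 /residual big_ord0 subrr.
by rewrite big_ord_recr /= IH subrKA.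
Qed.

Lemma cell_approx N i x : W i ->
  `|G i x - \sum_(k < N) G i (a k) * cell N k x| <= e + M * residual phi N N x.
Proof.
move=> Wi; set r := residual phi N N x.
have r01 : 0 <= r <= 1 by exact: residual01.
have -> : G i x - \sum_(k < N) G i (a k) * cell N k x =
    \sum_(k < N) (G i x - G i (a k)) * cell N k x + G i x * r.
  under [X in _ = X + _]eq_bigr do rewrite mulrBl.
  by rewrite sumrB -mulr_sumr sum_cell -/r mulrBr mulr1 addrAC subrK.
rewrite (le_trans (ler_normD _ _)) // lerD //; last first.
  rewrite normrM (ger0_norm (x := r)); last by case/andP: r01.
  by apply: ler_wpM2r; [case/andP: r01|exact: GM].
have -> : e = e * r + \sum_(k < N) e * cell N k x.
  by rewrite -mulr_sumr sum_cell -/r; lra.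
rewrite (le_trans (ler_norm_sum _ _ _)) // -[leLHS]add0r lerD //.
  by apply: mulr_ge0; [exact: ltW|case/andP: r01].
apply: ler_sum => k _; rewrite normrM (ger0_norm (cell_ge0 _ _ _)).
have [pk|pk] := eqVneq (phi k x) 0.
  by rewrite /cell residualS pk subr0 expr1n mulr1 subrr !mulr0.
by apply: ler_wpM2r; [exact: cell_ge0|rewrite distrC; exact: phiG].
Qed.

(** This isolates the dependence on [i] in the coefficients [G i (a k)]: the integrals on both sides
    of the finite approximation involve only functions common to the whole family. *)
Lemma Rintegral_cell_approx (mu : probability X R) N i : W i ->
  `|\int[mu]_x G i x - \sum_(k < N) G i (a k) * \int[mu]_x cell N k x| <=
    e + M * \int[mu]_x residual phi N N x.
Proof.
move=> Wi; have mu1 := probability_setT mu.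
have iG : mu.-integrable setT (EFin \o G i).
  exact: (bounded_integrableT mu1 (equicontinuous_measurable Wi) (fun x => GM x Wi)).
have iC k : mu.-integrable setT (EFin \o fun x => G i (a k) * cell N k x).
  apply: (bounded_integrableT mu1 (M := M)) => [|x].
    apply: measurable_funM; first exact: measurable_cst.
    exact/continuous_measurable/cell_continuous.
  by rewrite normrM -[leRHS]mulr1 ler_pM // ?cell_le1 // GM.
have iS : mu.-integrable setT (EFin \o fun x => \sum_(k < N) G i (a k) * cell N k x).
  have := integrable_sum (@measurableT _ X) (index_enum 'I_N) (P := xpredT)
    (fun k _ => iC k).
  by congr (_.-integrable _ _); apply/funext => x /=; rewrite sumEFin.
have iR : mu.-integrable setT (EFin \o fun x => M * residual phi N N x).
  apply: (bounded_integrableT mu1 (M := M)) => [|x].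
    apply: measurable_funM; first exact: measurable_cst.
    exact/continuous_measurable/residual_continuous.
  have /andP[r0 r1] := residual01 phi01 N N x.
  by rewrite ger0_norm ?mulr_ge0 // ler_piMr.
have ie : mu.-integrable setT (EFin \o fun x : X => e).
  by apply: (bounded_integrableT mu1 (M := `|e|)) => //; exact: measurable_cst.
have -> : \sum_(k < N) G i (a k) * \int[mu]_x cell N k x =
    \int[mu]_x (\sum_(k < N) G i (a k) * cell N k x).
  rewrite (Rintegral_sum (f := fun k x => G i (a k) * cell N k x)) //.
  by apply: eq_bigr => k _; rewrite RintegralZl //; exact: integrable_cell.
have -> : e + M * \int[mu]_x residual phi N N x =
    \int[mu]_x (e + M * residual phi N N x).
  rewrite RintegralD // RintegralZl //; last exact: integrable_residual.
  rewrite Rintegral_cst //; congr (_ + _); rewrite -[LHS]mulr1; congr (_ * _).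
  exact: (esym (congr1 fine mu1)).
have iB := integrableB (@measurableT _ X) iG iS.
rewrite -RintegralB // (le_trans (le_normr_Rintegral _ _)) //.
apply: le_Rintegral => //; last by move=> x _; exact: cell_approx.
  exact: (integrable_norm iB).
exact: (integrableD _ ie iR).
Qed.

Lemma Rintegral_residual_cvg0 (mu : probability X R) :
  \int[mu]_x residual phi N N x @[N --> \oo] --> 0.
Proof.
have : (\int[mu]_x (residual phi N N x)%:E @[N --> \oo] --> \int[mu]_x (cst 0 x)%:E)%E.
  apply: (dominated_cvg _ (g := cst 1%:E)) => //.
  - move=> N; apply/measurable_EFinP.
    exact/continuous_measurable/residual_continuous.
  - move=> x _; apply/cvg_EFin; first exact: nearW.
    exact: residual_cvg0.
  - apply: (bounded_integrableT (probability_setT mu) (M := 1)) => // x.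
    by rewrite normr1.
  - move=> N x _; have /andP[r0 r1] := residual01 phi01 N N x.
    by rewrite /= lee_fin ger0_norm.
by rewrite integral0 => /fine_cvg.
Qed.

End equicontinuous_weak_cvg.

Lemma equicontinuous_weak_cvg d (R : realType) (X : topMeasurableType d R) (I : Type)
    (W : set I) (G : I -> X -> R) (M eps : R)
    (zeta_ : nat -> probability X R) (zeta : probability X R) :
  standard_borel X -> weak_cvg zeta_ zeta -> 0 <= M ->
  equicontinuous W G -> (forall i x, W i -> `|G i x| <= M) -> 0 < eps ->
  \forall m \near \oo, forall i, W i ->
    `|\int[zeta_ m]_x G i x - \int[zeta]_x G i x| <= eps.
Proof.
move=> [mX _ _ [D [cD dD]]] wz M0 eG GM eps0.
have D0 : 0 < 2 + 4 * M by lra.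
(* The errors add up to [2 * e + 4 * M * e]: [e + 2 * M * e] for [zeta_ m], [e + M * e] for [zeta],
   and [M * e] between the two finite sums. *)
pose e := eps / (2 + 4 * M).
have e0 : 0 < e by rewrite divr_gt0.
have eE : (2 + 4 * M) * e = eps by rewrite /e mulrC divfK // gt_eqF.
have [phi [a [cphi phi01 phiG phi_cover]]] := equicontinuous_bumps cD dD eG e0.
have [N rN] : exists N, \int[zeta]_x residual phi N N x <= e.
  have /cvgrPdist_le/(_ e e0) := Rintegral_residual_cvg0 mX cphi phi01 phi_cover zeta.
  move=> /filter_ex[N]; rewrite sub0r normrN => rN.
  by exists N; exact: le_trans (ler_norm _) rN.
pose cell k x := residual phi N k x - residual phi N k.+1 x.
(* [N] cells share the error [e]; [N.+1] avoids dividing by zero when [N = 0]. *)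
have eN : 0 < e / N.+1%:R by rewrite divr_gt0.
have near_cell : \forall m \near \oo, forall k : 'I_N,
    `|\int[zeta_ m]_x cell k x - \int[zeta]_x cell k x| <= e / N.+1%:R.
  apply: filter_forall => k; apply: (weak_cvg_Rintegral mX wz _ _ eN (M := 1)).
    exact: cell_continuous.
  by move=> x; exact: cell_le1.
have near_res : \forall m \near \oo,
    `|\int[zeta_ m]_x residual phi N N x - \int[zeta]_x residual phi N N x| <= e.
  apply: (weak_cvg_Rintegral mX wz _ _ e0 (M := 1)).
    exact: residual_continuous.
  by move=> x; have /andP[? ?] := residual01 phi01 N N x; rewrite ger0_norm.
near=> m => i Wi.
have hc : forall k : 'I_N,
    `|\int[zeta_ m]_x cell k x - \int[zeta]_x cell k x| <= e / N.+1%:R by near: m.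
have hr : `|\int[zeta_ m]_x residual phi N N x - \int[zeta]_x residual phi N N x| <= e
  by near: m.
have ap mu := Rintegral_cell_approx mX M0 eG GM cphi phi01 phiG e0 mu N Wi.
have h1 := ap (zeta_ m); have h2 := ap zeta.
have h3 : `|\sum_(k < N) G i (a k) * \int[zeta_ m]_x cell k x -
            \sum_(k < N) G i (a k) * \int[zeta]_x cell k x| <= M * e.
  rewrite -sumrB (le_trans (ler_norm_sum _ _ _)) //.
  apply: (@le_trans _ _ (\sum_(k < N) M * (e / N.+1%:R))).
    by apply: ler_sum => k _; rewrite -mulrBr normrM ler_pM // GM.
  rewrite sumr_const card_ord -mulrnAr ler_wpM2l // -mulr_natr mulrAC ler_pdivrMr //.
  by rewrite ler_wpM2l ?(ltW e0) // ler_nat.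
have h4 : M * \int[zeta]_x residual phi N N x <= M * e by rewrite ler_wpM2l.
(* One [e] is the rest under [zeta], the other the weak convergence error of this one continuous
   function. *)
have h5 : M * \int[zeta_ m]_x residual phi N N x <= M * (2 * e).
  by rewrite ler_wpM2l //; move: hr; rewrite ler_norml => /andP[? ?]; lra.
move: h1 h2 h3; rewrite -eE !ler_norml => /andP[? ?] /andP[? ?] /andP[? ?].
by apply/andP; split; lra.
Unshelve. all: by end_near. Qed.

(** * Infima over policies and the value function *)

Lemma inf_dist_le (R : realType) (I : Type) (W : set I) (f g : I -> R) (M e : R) :
  W !=set0 -> (forall i, W i -> `|f i| <= M) -> (forall i, W i -> `|g i| <= M) ->
  (forall i, W i -> `|f i - g i| <= e) ->
  `|inf [set f i | i in W] - inf [set g i | i in W]| <= e.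
Proof.
move=> W0 fM gM fg.
have half (h k : I -> R) : (forall i, W i -> `|h i| <= M) ->
    (forall i, W i -> `|h i - k i| <= e) ->
    inf [set h i | i in W] - e <= inf [set k i | i in W].
  move=> hM hk; apply: lb_le_inf; first by case: W0 => i Wi; exists (k i); exists i.
  move=> _ [i Wi <-].
  have : inf [set h i | i in W] <= h i.
    apply: ge_inf; last by exists i.
    by exists (- M) => _ [j Wj <-]; have := hM j Wj; rewrite ler_norml => /andP[].
  by have := hk i Wi; rewrite ler_norml => /andP[? ?]; lra.
have gf i : W i -> `|g i - f i| <= e by move=> Wi; rewrite distrC fg.
have := half f g fM fg; have := half g f gM gf.
by rewrite ler_norml => ? ?; apply/andP; split; lra.
Qed.

Theorem theorem4p2 (R : realType) (n : nat)
  (dX : measure_display) (X : topMeasurableType dX R)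
  (dY : 'I_n -> measure_display) (Y : forall i : 'I_n, topMeasurableType (dY i) R)
  (dU : 'I_n -> measure_display) (U : forall i : 'I_n, topMeasurableType (dU i) R)
  (Q : forall i : 'I_n, R.-pker X ~> Y i)
  (c : X * prod_topology (fun i : 'I_n => (U i : topologicalType)) -> R)
  (zeta_ : nat -> probability X R) (zeta : probability X R) :
  standard_borel X ->
  (forall i, standard_borel (Y i)) ->
  (forall i, standard_borel (U i)) ->
  (* A2 *) continuous c -> (exists M : R, forall p, `|c p| <= M) ->
  (* A4 *) (forall i, compact [set: U i]) ->
  (* A6 *) (forall i, tv_continuous (Q i)) ->
  (* A3 for every prior considered *)
  assumption_A3 Q zeta -> (forall m, assumption_A3 Q (zeta_ m)) ->
  weak_cvg zeta_ zeta ->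
  (team_value Q c (zeta_ m) @[m --> \oo] --> team_value Q c zeta)%E.
Proof.
move=> sX _ sU cc [M cM] kU cQ _ _ wz.
have mU i : @measurable _ (U i) = <<s @open (U i) >> by case: (sU i).
have mX : @measurable _ X = <<s @open X >> by case: sX.
have M0 : 0 <= M := le_trans (normr_ge0 _) (cM (point, fun=> point)).
pose W : set (forall i, Y i -> U i) := team_policy.
have W0 : W !=set0 by exists (fun i => cst point) => i; exact: measurable_cst.
pose G := conditional_cost Q c.
have GM gamma x : W gamma -> `|G gamma x| <= M.
  by move=> Wg; exact: (conditional_cost_bounded mU kU cQ cc cM).
have eG : equicontinuous W G := conditional_cost_equicontinuous mU kU cQ cc cM.
pose J (mu : probability X R) gamma := \int[mu]_x G gamma x.
have mG gamma (Wg : W gamma) := equicontinuous_measurable mX eG Wg.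
have JM mu gamma : W gamma -> `|J mu gamma| <= M.
  move=> Wg; apply: Rintegral_norm_le; first exact: probability_setT.
    exact: mG.
  by move=> x; exact: GM.
(* Constant policies and the uniform bound [M] make the extended infimum a real one, so that
   distances between values make sense. *)
have valueE mu : team_value Q c mu = (inf [set J mu gamma | gamma in W])%:E.
  rewrite -ereal_inf_EFin; last 2 first.
  - exists (- M) => _ [gamma Wg <-].
    by have := JM mu gamma Wg; rewrite ler_norml => /andP[].
  - by case: W0 => gamma Wg; exists (J mu gamma); exists gamma.
  congr ereal_inf; rewrite image_comp; apply: eq_imagel => gamma Wg.
  rewrite (team_costE mU kU cQ cc cM) // /= /J /Rintegral fineK //.
  apply: integrable_fin_num => //.
  exact: (bounded_integrableT (probability_setT mu) (mG _ Wg) (fun x => GM _ x Wg)).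
rewrite valueE; under eq_fun do rewrite valueE.
apply: cvg_EFin; first exact: nearW.
apply/cvgrPdist_le => eps eps0.
apply: filterS (equicontinuous_weak_cvg sX wz M0 eG GM eps0) => m Jm /=.
by rewrite distrC; exact: inf_dist_le (JM _) (JM _) Jm.
Qed.
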